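(* Let $q$ be an integer with $|q|\neq 0,1$, and let $$Ln_q(2)=\sum_{n=1}^{\infty}\frac{(-1)^n}{q^n-1}.$$ Then $Ln_q(2)$ is irrational, and its irrationality measure is at most $4.8$.
   Context: The irrationality measure $\mu(x)$ of a real number $x$ is the infimum of all $\mu$ such that $\left|x-\frac{p}{r}\right|<\frac{1}{r^{\mu}}$ has only finitely many solutions in integers $p$ and $r\ge 1$. *)

(* Defs.v *)
From HB Require Import structures.
From mathcomp Require Import all_boot all_order all_algebra.
From mathcomp Require Import all_classical all_reals all_analysis.
Set Implicit Arguments. Unset Strict Implicit. Unset Printing Implicit Defensive.
Import Order.TTheory GRing.Theory Num.Theory.
Import numFieldNormedType.Exports.
Local Open Scope classical_set_scope.
Local Open Scope ring_scope.

Definition Lnq2 (R : realType) (q : int) : R :=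
  limn (fun N : nat => \sum_(1 <= n < N) ((-1) ^+ n / ((q%:~R : R) ^+ n - 1))).

Definition finitely_many_approx (R : realType) (x mu : R) : Prop :=
  finite_set [set pr : int * int |
    (1 <= pr.2)%R /\ `| x - (pr.1%:~R : R) / (pr.2%:~R : R) | < (((pr.2%:~R : R) `^ mu)^-1)].

Definition irr_measure (R : realType) (x : R) : \bar R :=
  ereal_inf [set mu%:E | mu in [set mu : R | finitely_many_approx x mu]].

(* Main.v *)
Require Import Defs.
From HB Require Import structures.
From mathcomp Require Import all_boot all_order all_algebra.
From mathcomp Require Import all_classical all_reals all_analysis.
From mathcomp Require Import ring lra zify.
Set Implicit Arguments. Unset Strict Implicit. Unset Printing Implicit Defensive.
Import Order.TTheory GRing.Theory Num.Theory.
Import numFieldNormedType.Exports.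
Local Open Scope ring_scope.

(* Put R(T) = T^-s * prod_(1 <= j <= 2s) (T - q^j) / prod_(0 <= k <= 2s) (1 - q^k T).
   Expanding R into partial fractions and summing (-1)^t R(q^t) over t >= 1
   gives a linear form in 1 and L = Ln_q(2). The terms with t <= 2s vanish and
   the next ones decrease geometrically, so the sum is comparable to its first
   nonzero term, of size |q|^(-4s^2 + O(s)). The residues are, up to sign,
   products of two Gaussian binomials and of a power of q of exponent
   k(k+1)/2 - ks >= -s(s-1)/2; hence the factor
   q^(s(s-1)/2) * prod_(s < m <= 2s) (q^m - 1), of size |q|^(2s^2 + O(s)),
   makes the form integral. This yields integers b, c with
   |b| <= |q|^(6s^2 + O(s)) and |b L - c| = |q|^(-2s^2 + O(s)), the latter with
   a matching lower bound, so b L - c never vanishes. Such approximations force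
   L to be irrational with measure at most 1 + 6/2 = 4 < 4.8. *)

(** * Gaussian binomials and q-factorials *)

(** Defined by the q-Pascal rule rather than as a quotient, so that values lie in every subring
    containing [x]. *)
Fixpoint qbin (F : comNzRingType) (x : F) (m k : nat) : F :=
  match m, k with
  | _, 0 => 1
  | 0, _.+1 => 0
  | m'.+1, k'.+1 => qbin x m' k' + x ^+ k * qbin x m' k
  end.

Definition qfact (F : comNzRingType) (x : F) (m : nat) : F :=
  \prod_(i < m) (x ^+ i.+1 - 1).

Section QBinomial.
Variables (F : comNzRingType) (x : F).

Lemma qfactS m : qfact x m.+1 = qfact x m * (x ^+ m.+1 - 1).
Proof. by rewrite /qfact big_ord_recr. Qed.

Lemma qbin0 m : qbin x m 0 = 1. Proof. by case: m. Qed.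

Lemma qbinS m k :
  qbin x m.+1 k.+1 = qbin x m k + x ^+ k.+1 * qbin x m k.+1.
Proof. by []. Qed.

Lemma qbin_small m k : (m < k)%N -> qbin x m k = 0.
Proof.
elim: m k => [|m IH] [|k] //= mk.
by rewrite !IH ?mulr0 ?addr0 //; lia.
Qed.

(** The quotient formula for Gaussian binomials, free of division so that it holds in any
    commutative ring. *)
Lemma qbin_fact k l : qbin x (k + l) k * qfact x k * qfact x l = qfact x (k + l).
Proof.
elim: k l => [|k IHk] l.
  by rewrite add0n qbin0 /qfact big_ord0 !mul1r.
elim: l => [|l IHl].
  have := IHk 0%N; rewrite !addn0 qbinS => {}IHk.
  rewrite (@qbin_small k k.+1) // mulr0 addr0 !qfactS -[in RHS]IHk.
  by ring.
have := IHk l.+1; rewrite !addnS !addSn qbinS (qfactS (_ + _).+1) => {}IHk.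
rewrite addSn in IHl.
(* The two terms recombine through x^(k+l+2) - 1 = (x^(k+1) - 1) + x^(k+1) (x^(l+1) - 1). *)
transitivity (qbin x (k + l).+1 k * qfact x k * qfact x l.+1 * (x ^+ k.+1 - 1)
  + (qbin x (k + l).+1 k.+1 * qfact x k.+1 * qfact x l) * (x ^+ k.+1 * (x ^+ l.+1 - 1))).
  by rewrite (qfactS k) (qfactS l); ring.
rewrite IHk IHl -mulrDr; congr (_ * _).
by rewrite -(addnS k l) -addSn exprD; ring.
Qed.

Lemma prodr_split_neq (G : nat -> F) n k : (k <= n)%N ->
  \prod_(i < n.+1 | val i != k) G i =
  (\prod_(i < k) G i) * \prod_(i < n - k) G (k + i.+1)%N.
Proof.
move=> kn; rewrite -(big_mkord (fun i => i != k) G).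
rewrite (@big_cat_nat _ _ _ k) //=; last lia.
congr (_ * _).
  rewrite -(big_mkord xpredT G) big_nat_cond [RHS]big_nat_cond.
  by apply: eq_bigl => i /=; lia.
rewrite big_ltn_cond; [|lia]; rewrite eqxx /=.
rewrite -[X in \big[_/_]_(X <= _ < _ | _) _]add0n big_addn subSS big_nat_cond.
rewrite -(big_mkord xpredT (fun i => G (k + i.+1)%N)) [RHS]big_nat_cond.
apply: eq_big => [i|i _]; first lia.
by rewrite addnC -addSnnS.
Qed.

End QBinomial.

(** * Partial fractions with simple poles *)

Section PartialFractions.
Variable F : fieldType.

(** Lagrange interpolation of [W] at the [n] distinct nodes 1/b_k, divided by the product of all the
    factors. *)
Lemma partial_fractions n (b : 'I_n -> F) (W : {poly F}) (z : F) :
  injective b -> (forall i, b i != 0) -> (size W <= n)%N ->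
  (forall i, 1 - b i * z != 0) ->
  W.[z] / \prod_i (1 - b i * z) =
  \sum_k W.[(b k)^-1] / \prod_(i | i != k) (1 - b i / b k) / (1 - b k * z).
Proof.
move=> injb b0 sW zb.
pose L k : {poly F} := \prod_(i | i != k) (1 - b i *: 'X).
have LE k y : (L k).[y] = \prod_(i | i != k) (1 - b i * y).
  by rewrite horner_prod; apply: eq_bigr => i _; rewrite !hornerE.
have sL k : (size (L k) <= n)%N.
  apply: leq_trans (size_prod_leq _ _) _.
  have : (\sum_(i | i != k) size (1 - b i *: 'X : {poly F})%R <= \sum_(i < n | i != k) 2)%N.
    apply: leq_sum => i _.
    rewrite (leq_trans (size_polyD _ _)) // geq_max size_poly1 /= size_polyN.
    by rewrite (leq_trans (size_scale_leq _ _)) // size_polyX.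
  rewrite sum_nat_const.
  have := cardC1 k; rewrite card_ord => ->.
  have : (0 < n)%N by case: (k); lia.
  set c := (\sum_(_ | _) _)%N; lia.
(* The interpolant: [L k] vanishes at every node except 1/b_k. *)
pose P := \sum_k (W.[(b k)^-1] / \prod_(i | i != k) (1 - b i / b k)) *: L k.
have L0 j k : j != k -> (L k).[(b j)^-1] = 0.
  move=> jk; rewrite LE (bigD1 j) //= divff ?b0 // subrr mul0r //.
have Lk k : (L k).[(b k)^-1] != 0.
  rewrite LE; apply/prodf_neq0 => i ik.
  rewrite subr_eq0 eq_sym; apply: contra ik => /eqP e.
  by apply/eqP/injb; rewrite -[LHS](divfK (b0 k)) e mul1r.
have WP : W = P.
  apply/eqP; rewrite -subr_eq0; apply/eqP.
  apply: (@roots_geq_poly_eq0 _ _ [seq (b i)^-1 | i <- enum 'I_n]).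
  - apply/allP => _ /mapP [j _ ->]; rewrite /root !hornerE horner_sum.
    rewrite (bigD1 j) //= [X in _ - (_ + X)]big1 => [|k kj].
      rewrite !hornerE -LE divfK ?Lk //.
      by rewrite subrr.
    by rewrite hornerE L0 1?eq_sym // mulr0.
  - by rewrite map_inj_uniq ?enum_uniq // => i j /invr_inj /injb.
  - rewrite size_map size_enum_ord (leq_trans (size_polyD _ _)) // size_polyN.
    rewrite geq_max sW (leq_trans (size_sum _ _ _)) //.
    by apply/bigmax_leqP => k _; rewrite (leq_trans (size_scale_leq _ _)).
rewrite {1}WP horner_sum mulr_suml; apply: eq_bigr => k _.
rewrite hornerE LE -!mulrA; congr (_ * (_ * _)).
rewrite [X in _ / X](bigD1 k) //=.
have := zb k; have : \prod_(i | i != k) (1 - b i * z) != 0 by apply/prodf_neq0.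
set A := \prod_(_ | _) _; set B := 1 - _ => A0 B0.
by field; rewrite A0 B0.
Qed.

End PartialFractions.

(** * Division of polynomials along increasing powers *)

Section SeriesDivision.
Variables (F : idomainType) (S : subringClosed F).

(** [V] is the power series N/M truncated at order [s]. Since [M] has constant term 1, its
    coefficients stay in [S]. It will describe the pole of the kernel at T = 0. *)
Lemma divXn_series (N M : {poly F}) s : N \is a polyOver S -> M \is a polyOver S ->
  M`_0 = 1 -> exists V W : {poly F},
  [/\ V \is a polyOver S, (size V <= s)%N & N = V * M + 'X^s * W].
Proof.
move=> NS MS M0.
(* The induction also needs [W] over [S], because its constant term is the next coefficient of
   [V]. *)
suff [V [W [? _ ? ?]]] : exists V W : {poly F},
  [/\ V \is a polyOver S, W \is a polyOver S, (size V <= s)%N & N = V * M + 'X^s * W].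
  by exists V, W.
elim: s => [|s [V [W [VS WS sV NE]]]].
  exists 0, N; rewrite rpred0 NS size_poly0; split => //.
  by rewrite mul0r add0r mul1r.
have W0 : W`_0 \in S by move/polyOverP: WS.
pose U := W - W`_0 *: M.
have US : U \is a polyOver S by rewrite rpredB // polyOverZ.
exists (V + W`_0 *: 'X^s), (drop_poly 1 U); split.
- by rewrite rpredD // polyOverZ // polyOverXn.
- by apply/polyOverP => i; rewrite coef_drop_poly; move/polyOverP: US.
- rewrite (leq_trans (size_polyD _ _)) // geq_max (leq_trans sV) //=.
  by rewrite (leq_trans (size_scale_leq _ _)) // size_polyXn.
- have UE : U = drop_poly 1 U * 'X.
    rewrite -{1}(poly_take_drop 1 U) expr1.
    suff -> : take_poly 1 U = 0 by rewrite add0r.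
    apply/polyP => i; rewrite coef_take_poly coef0; case: ltnP => //.
    by case: i => // _; rewrite coefB coefZ M0 mulr1 subrr.
  rewrite exprSr -mulrA (mulrC 'X) -UE /U NE -!mul_polyC; ring.
Qed.
End SeriesDivision.

(** * Decomposition of the kernel into partial fractions *)

(* By legendre_expE the subtraction does not truncate. *)
Definition legendre_exp (s k : nat) : nat := ('C(k.+1, 2) + 'C(s, 2) - k * s)%N.

(** A q-analogue of C(k + 2s, k) C(2s, k), the coefficients up to sign of the shifted Legendre
    polynomial of degree 2s. *)
Definition legendre_coef (F : comNzRingType) (x : F) (s k : nat) : F :=
  x ^+ legendre_exp s k * qbin x (k + 2 * s) k * qbin x (2 * s) k.

(* The value R(x^t) of the rational function R. *)
Definition kernel_fun (F : fieldType) (x : F) (s t : nat) : F :=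
  \prod_(j < 2 * s) (x ^+ t - x ^+ j.+1) /
  (x ^+ (t * s) * \prod_(k < (2 * s).+1) (1 - x ^+ (k + t))).

Lemma bin2S_double n : ('C(n.+1, 2) * 2 = n.+1 * n)%N.
Proof.
elim: n => // n IH; rewrite binS bin1 mulnDl IH; lia.
Qed.

(** The exponent equals (k - s)(k - s + 1)/2, which is nonnegative for all integers [k] and [s]. *)
Lemma legendre_expE s k : (legendre_exp s k + k * s = 'C(k.+1, 2) + 'C(s, 2))%N.
Proof.
rewrite /legendre_exp subnK //.
case: s => [|s]; first by rewrite muln0.
have := bin2S_double k; have := bin2S_double s; move: 'C(_, _) 'C(_, _) => B C.
have [/subnKC <-|/subnKC <-] := leqP k s; [move: (s - k)%N|move: (k - s.+1)%N] => d.
  nia.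
nia.
Qed.

Section Decomposition.
Variables (F : fieldType) (x : F).
Hypotheses (x0 : x != 0) (x1 : forall m, x ^+ m.+1 != 1).

Lemma qfact_neq0 m : qfact x m != 0.
Proof. by apply/prodf_neq0 => i _; rewrite subr_eq0. Qed.

Lemma qfactD k n : qfact x (k + n) = qfact x k * \prod_(j < n) (x ^+ (k + j.+1) - 1).
Proof.
by rewrite /qfact big_split_ord; congr (_ * _); apply: eq_bigr => i _ /=; rewrite addnS.
Qed.

Lemma prod_lower k :
  \prod_(i < k) (1 - x ^+ i / x ^+ k) = qfact x k / x ^+ 'C(k.+1, 2).
Proof.
have -> : 'C(k.+1, 2) = (\sum_(i < k) i.+1)%N.
  elim: k => [|k IH]; first by rewrite big_ord0.
  by rewrite binS bin1 big_ord_recr /= IH addnC.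
rewrite -prodrXr /qfact -prodf_div (reindex_inj rev_ord_inj) /=.
apply: eq_bigr => i _; have ki := ltn_ord i.
have xi := expf_neq0 (k - i.+1) x0; have xi' := expf_neq0 i.+1 x0.
have -> : x ^+ k = x ^+ (k - i.+1) * x ^+ i.+1 by rewrite -exprD subnK.
by field; rewrite xi xi'.
Qed.

Lemma prod_upper n : \prod_(i < n) (1 - x ^+ i.+1) = (-1) ^+ n * qfact x n.
Proof.
rewrite /qfact -[in (-1) ^+ n](card_ord n) -(prodrN 'I_n).
by apply: eq_bigr => i _; rewrite opprB.
Qed.

Lemma expr_base_inj : injective (fun k : nat => x ^+ k).
Proof.
suff W i j : (i < j)%N -> x ^+ i != x ^+ j.
  move=> i j /= e; have [/W|/W|//] := ltngtP i j; by rewrite e eqxx.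
move=> ij; rewrite -(subnKC ij) addSn -addnS exprD -{1}[x ^+ i]mulr1.
by rewrite (inj_eq (mulfI (expf_neq0 _ x0))) eq_sym x1.
Qed.

(** The left side is x^C(s,2) times the coefficient of 1/(1 - x^k T) in the kernel. The factors with
    i < k and with i > k give the q-factorials of k and 2s - k, while the numerator gives a quotient
    of the q-factorials of k + 2s and k. Together they form two Gaussian binomials. *)
Lemma residueE s k : (k <= 2 * s)%N ->
  x ^+ 'C(s, 2) * (x ^+ (k * s) * \prod_(j < 2 * s) ((x ^+ k)^-1 - x ^+ j.+1)) /
    \prod_(i < (2 * s).+1 | val i != k) (1 - x ^+ i / x ^+ k) =
  (-1) ^+ k * legendre_coef x s k.
Proof.
move=> ks; have xk0 := expf_neq0 k x0.
rewrite (@prodr_split_neq _ (fun i => 1 - x ^+ i / x ^+ k)) // prod_lower.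
have -> : \prod_(i < 2 * s - k) (1 - x ^+ (k + i.+1) / x ^+ k) =
    (-1) ^+ (2 * s - k) * qfact x (2 * s - k).
  rewrite -prod_upper; apply: eq_bigr => i _.
  by rewrite exprD [x ^+ k * _]mulrC mulfK.
have -> : \prod_(j < 2 * s) ((x ^+ k)^-1 - x ^+ j.+1) =
   (x ^+ (k * s) ^+ 2)^-1 * \prod_(j < 2 * s) (x ^+ (k + j.+1) - 1).
  transitivity (\prod_(j < 2 * s) (- (x ^+ k)^-1 * (x ^+ (k + j.+1) - 1))).
    by apply: eq_bigr => j _; rewrite exprD; field.
  rewrite big_split /= prodr_const card_ord exprM sqrrN exprVn -!exprM.
  by rewrite exprVn -exprM; congr ((_ ^+ _)^-1 * _); lia.
have E1 := qbin_fact x k (2 * s); rewrite qfactD -mulrA mulrCA in E1.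
have /(mulfI (qfact_neq0 k)) {}E1 := E1.
have E2 := qbin_fact x k (2 * s - k); rewrite subnKC // in E2.
rewrite -E1 -E2 /legendre_coef.
have EE : x ^+ legendre_exp s k * x ^+ (k * s) = x ^+ 'C(k.+1, 2) * x ^+ 'C(s, 2).
  by rewrite -!exprD legendre_expE.
have h1 := qfact_neq0 k; have h2 := qfact_neq0 (2 * s - k).
have h3 := expf_neq0 'C(k.+1, 2) x0; have h4 := expf_neq0 (k * s) x0.
(* The order 2s is even, so only the parity of [k] matters. *)
have sgn : (-1 : F) ^+ (2 * s - k) = (-1) ^+ k.
  by rewrite -[LHS]signr_odd oddB // mul2n odd_double /= signr_odd.
rewrite sgn -[x ^+ legendre_exp s k](mulfK h4) EE -[in RHS]invr_sign.
have : (-1 : F) ^+ k != 0 by rewrite signr_eq0.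
move: ((-1) ^+ k) => e e0.
by field; rewrite h1 h2 h3 h4 e0.
Qed.

Lemma size_prod_1BZX m (b : 'I_m -> F) :
  (size (\prod_i (1 - b i *: 'X : {poly F}))%R <= m.+1)%N.
Proof.
elim: m b => [|m IH] b; first by rewrite big_ord0 size_poly1.
rewrite big_ord_recl (leq_trans (size_polyMleq _ _)) //.
have := IH (fun i => b (lift ord0 i)).
have : (size (1 - b ord0 *: 'X : {poly F})%R <= 2)%N.
  rewrite (leq_trans (size_polyD _ _)) // geq_max size_poly1 /= size_polyN.
  by rewrite (leq_trans (size_scale_leq _ _)) // size_polyX.
move=> h2 h1; by rewrite -subn1 leq_subLR (leq_trans (leq_add h2 h1)).
Qed.

(** Writing the numerator as V M + T^s W splits the kernel into V/T^s, the pole at 0, and W/M, with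
    simple poles at the x^-k. The factor x^C(s,2) clears the negative powers of [x] in the
    residues. *)
Lemma kernel_decomp (S : subringClosed F) s : x \in S ->
  exists V : nat -> F, (forall i, V i \in S) /\ forall t, (0 < t)%N ->
    x ^+ 'C(s, 2) * kernel_fun x s t =
    \sum_(k < (2 * s).+1) (-1) ^+ k * legendre_coef x s k / (1 - x ^+ (k + t)) +
    \sum_(i < s) V i / x ^+ (t * (s - i)).
Proof.
move=> xS.
pose N : {poly F} := \prod_(j < 2 * s) ('X - (x ^+ j.+1)%:P).
pose M : {poly F} := \prod_(k < (2 * s).+1) (1 - x ^+ k *: 'X).
have NE y : N.[y] = \prod_(j < 2 * s) (y - x ^+ j.+1).
  by rewrite horner_prod; apply: eq_bigr => j _; rewrite !hornerE.
have ME y : M.[y] = \prod_(k < (2 * s).+1) (1 - x ^+ k * y).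
  by rewrite horner_prod; apply: eq_bigr => j _; rewrite !hornerE.
have NS : N \is a polyOver S.
  by apply: rpred_prod => j _; rewrite polyOverXsubC rpredX.
have MS : M \is a polyOver S.
  by apply: rpred_prod => j _; rewrite rpredB ?rpred1 // polyOverZ ?polyOverX // rpredX.
have M0 : M`_0 = 1.
  by rewrite -horner_coef0 ME big1 // => i _; rewrite mulr0 subr0.
have sN : size N = (2 * s).+1 by rewrite size_prod_XsubC /index_enum -enumT size_enum_ord.
have [V [W [VS sV NVW]]] := divXn_series s NS MS M0.
(* Both [N] and [V * M] have degree at most 3s, so [W] has degree at most 2s, below the number 2s +
   1 of poles. *)
have sW : (size W <= (2 * s).+1)%N.
  have [->|W0] := eqVneq W 0; first by rewrite size_poly0.
  have : (size ('X^s * W : {poly F})%R <= (3 * s).+1)%N.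
    have -> : 'X^s * W = N - V * M by rewrite NVW addrC addKr.
    rewrite (leq_trans (size_polyD _ _)) // geq_max sN size_polyN.
    rewrite (leq_trans (size_polyMleq _ _)) ?andbT; first by lia.
    have sM : (size M <= (2 * s).+2)%N := size_prod_1BZX (fun k : 'I_(2 * s).+1 => x ^+ k).
    by rewrite -subn1 leq_subLR (leq_trans (leq_add sV sM)) //; lia.
  rewrite mulrC size_mulXn // => sXW; rewrite -(leq_add2l s) (leq_trans sXW) //; lia.
exists (fun i => x ^+ 'C(s, 2) * V`_i); split.
  by move=> i; rewrite rpredM ?rpredX //; move/polyOverP: VS.
move=> t t0; have xt0 := expf_neq0 t x0.
have nz (i : 'I_(2 * s).+1) : 1 - x ^+ i * x ^+ t != 0.
  by rewrite -exprD subr_eq0 eq_sym -(prednK t0) addnS x1.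
have pf := partial_fractions (b := fun k : 'I_(2 * s).+1 => x ^+ k) (W := W) (z := x ^+ t) _ _ sW nz.
have {}pf := pf (fun i j e => val_inj (expr_base_inj e)) (fun i => expf_neq0 _ x0).
have Mt : M.[x ^+ t] != 0 by rewrite ME; apply/prodf_neq0.
have -> : kernel_fun x s t = V.[x ^+ t] / x ^+ (t * s) + W.[x ^+ t] / M.[x ^+ t].
  rewrite /kernel_fun -NE NVW.
  have -> : \prod_(k < (2 * s).+1) (1 - x ^+ (k + t)) = M.[x ^+ t].
    by rewrite ME; apply: eq_bigr => k _; rewrite exprD.
  rewrite !hornerE exprM.
  have := expf_neq0 s xt0; move: Mt; move: (M.[_]) (_ ^+ s) => m y m0 y0.
  by field; rewrite m0 y0.
rewrite mulrDr addrC; congr (_ + _); last first.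
  rewrite (horner_coef_wide _ sV) mulr_suml mulr_sumr; apply: eq_bigr => i _.
  rewrite -!mulrA; congr (_ * (_ * _)).
  rewrite -{2}(subnK (ltnW (ltn_ord i))) mulnDr exprD -exprM.
  by rewrite invfM mulrA [x ^+ _ * _]mulrC mulfK ?expf_neq0.
rewrite ME pf mulr_sumr; apply: eq_bigr => k _.
rewrite exprD mulrA; congr (_ / _); rewrite -residueE -1?ltnS //.
rewrite -mulrA; congr (_ * (_ / _)).
(* At the node x^-k the polynomial [M] vanishes, which expresses the value of [W] by that of [N]. *)
have : N.[(x ^+ k)^-1] = (x ^+ (k * s))^-1 * W.[(x ^+ k)^-1].
  rewrite NVW hornerD !hornerM ME.
  rewrite (bigD1 k) //= divff ?expf_neq0 // subrr mul0r mulr0 add0r.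
  by rewrite hornerXn exprVn exprM.
by rewrite NE => ->; rewrite mulVKf ?expf_neq0.
Qed.

End Decomposition.

(** * The common denominator *)

(** Keeping only the factors with s < m <= 2s gives degree (3s^2 + s)/2 in [x], against 2s^2 + s for
    all m <= 2s. *)
Definition denom (F : comNzRingType) (x : F) (s : nat) : F :=
  \prod_(i < s) (x ^+ (s + i.+1) - 1).

Section Denominators.
Variables (F : fieldType) (x : F) (S : subringClosed F).
Hypotheses (x1 : forall m, x ^+ m.+1 != 1) (xS : x \in S).

Lemma qbin_in m k : qbin x m k \in S.
Proof.
elim: m k => [|m IH] [|k] /=; rewrite ?rpred0 ?rpred1 //.
by rewrite rpredD // rpredM // rpredX.
Qed.

Lemma legendre_coef_in s k : legendre_coef x s k \in S.
Proof. by rewrite !rpredM ?rpredX ?qbin_in. Qed.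

Lemma denom_in s : denom x s \in S.
Proof. by apply: rpred_prod => i _; rewrite rpredB ?rpredX ?rpred1. Qed.

(* Every m <= 2s has a multiple in (s, 2s]. *)
Lemma denom_divB s m : (0 < m <= 2 * s)%N -> denom x s / (x ^+ m - 1) \in S.
Proof.
move=> /andP[m0 ms]; set d := (2 * s %/ m)%N.
have d0 : (0 < d)%N by rewrite divn_gt0.
have sd : (s < m * d <= 2 * s)%N.
  have := divn_eq (2 * s) m; have := ltn_pmod (2 * s) m0; rewrite -/d; nia.
have jP : ((m * d - s).-1 < s)%N by lia.
rewrite /denom (bigD1 (Ordinal jP)) //= mulrAC rpredM //; last first.
  by apply: rpred_prod => i _; rewrite rpredB ?rpredX ?rpred1.
have -> : (s + (m * d - s).-1.+1)%N = (m * d)%N by lia.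
rewrite exprM subrX1 mulrC mulKf; last first.
  by rewrite -(prednK m0) subr_eq0.
by apply: rpred_sum => i _; rewrite !rpredX.
Qed.

(** Here x^i + 1 divides x^(2i) - 1, and 2i <= 2s. These denominators arise from summing the pole of
    the kernel at 0. *)
Lemma denom_divD s i : (0 < i <= s)%N -> denom x s / (x ^+ i + 1) \in S.
Proof.
move=> /andP[i0 si].
have E : x ^+ (2 * i) - 1 = (x ^+ i - 1) * (x ^+ i + 1).
  by rewrite mul2n -addnn exprD; ring.
have i1 : x ^+ i - 1 != 0 by rewrite -(prednK i0) subr_eq0.
have i2 : x ^+ i + 1 != 0.
  have : x ^+ (2 * i) - 1 != 0.
    by rewrite -[(2 * i)%N]prednK ?muln_gt0 // subr_eq0.
  by rewrite E mulf_eq0 negb_or => /andP[].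
have -> : denom x s / (x ^+ i + 1) = denom x s / (x ^+ (2 * i) - 1) * (x ^+ i - 1).
  by rewrite E; field; rewrite i1 i2.
by rewrite rpredM ?rpredB ?rpredX ?rpred1 // denom_divB //; lia.
Qed.

End Denominators.

(** * Zeros and recurrence of the kernel in [t] *)

Section KernelRatio.
Variables (F : fieldType) (x : F).
Hypotheses (x0 : x != 0) (x1 : forall m, x ^+ m.+1 != 1).

Lemma kernel_fun_eq0 s t : (0 < t <= 2 * s)%N -> kernel_fun x s t = 0.
Proof.
case: t => // t /= ts; rewrite /kernel_fun.
by rewrite (bigD1 (Ordinal ts)) //= subrr !mul0r.
Qed.

(** Passing from t to t + 1 shifts both products by one index, so only their end factors change. The
    cross-multiplied form also covers t = 2s, where the factor x^t - x^(2s) vanishes. *)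
Lemma kernel_funS s t : (0 < t)%N ->
  kernel_fun x s t.+1 * (x ^+ s * ((x ^+ t - x ^+ (2 * s)) * (1 - x ^+ (t + 2 * s).+1))) =
  kernel_fun x s t * (x ^+ (2 * s) * ((x ^+ t - 1) * (1 - x ^+ t))).
Proof.
move=> t0; rewrite /kernel_fun.
have NE : (\prod_(j < 2 * s) (x ^+ t.+1 - x ^+ j.+1)) * (x ^+ t - x ^+ (2 * s)) =
    x ^+ (2 * s) * ((x ^+ t - 1) * \prod_(j < 2 * s) (x ^+ t - x ^+ j.+1)).
  have -> : \prod_(j < 2 * s) (x ^+ t.+1 - x ^+ j.+1) =
      x ^+ (2 * s) * \prod_(j < 2 * s) (x ^+ t - x ^+ j).
    rewrite -[in X in X * _](card_ord (2 * s)) -prodr_const -big_split /=.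
    by apply: eq_bigr => j _; rewrite !exprS mulrBr.
  rewrite -mulrA; congr (_ * _).
  rewrite -(big_ord_recr _ (fun j => x ^+ t - x ^+ j)) big_ord_recl expr0.
  by congr (_ * _); apply: eq_bigr.
have DE : (\prod_(k < (2 * s).+1) (1 - x ^+ (k + t.+1))) * (1 - x ^+ t) =
    (\prod_(k < (2 * s).+1) (1 - x ^+ (k + t))) * (1 - x ^+ (t + 2 * s).+1).
  rewrite -addnS [(t + _)%N]addnC.
  rewrite -(big_ord_recr _ (fun k => 1 - x ^+ (k + t))) [RHS]big_ord_recl mulrC.
  by congr (_ * _); apply: eq_bigr => k _; rewrite addnS addSn.
have D0 t' : (0 < t')%N -> \prod_(k < (2 * s).+1) (1 - x ^+ (k + t')) != 0.
  case: t' => // t' _; apply/prodf_neq0 => k _.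
  by rewrite subr_eq0 eq_sym addnS x1.
have t1 : 1 - x ^+ t != 0 by rewrite subr_eq0 eq_sym -(prednK t0).
have := D0 t.+1 isT.
have : x ^+ (t * s) != 0 by rewrite expf_neq0.
have : x ^+ s != 0 by rewrite expf_neq0.
rewrite (mulSn t) exprD.
move: (x ^+ s) (x ^+ (t * s)) => y z y0 z0 D1.
have -> : \prod_(k < (2 * s).+1) (1 - x ^+ (k + t)) =
   (\prod_(k < (2 * s).+1) (1 - x ^+ (k + t.+1))) * (1 - x ^+ t) / (1 - x ^+ (t + 2 * s).+1).
  by rewrite DE mulfK // subr_eq0 eq_sym.
transitivity (\prod_(j < 2 * s) (x ^+ t.+1 - x ^+ j.+1) * (x ^+ t - x ^+ (2 * s)) *
   (1 - x ^+ (t + 2 * s).+1) / (z * \prod_(k < (2 * s).+1) (1 - x ^+ (k + t.+1)))).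
    by field; rewrite y0 z0 D1.
have t2 : 1 - x ^+ (t + 2 * s).+1 != 0 by rewrite subr_eq0 eq_sym.
by rewrite NE; field; rewrite z0 D1 t1 t2.
Qed.

End KernelRatio.

(** * Size estimates in powers of |x| *)

Section Bounds.
Variables (R : realFieldType) (x : R).
Hypothesis x2 : 2 <= `|x|.
Local Notation a := (`|x|).

Lemma base_gt0 : 0 < a. Proof. by apply: lt_le_trans x2. Qed.
Lemma base_ge1 : 1 <= a. Proof. by apply: le_trans x2; rewrite ler1n. Qed.

Lemma base_exp_gt0 n : 0 < a ^+ n.
Proof. by rewrite exprn_gt0 // base_gt0. Qed.

Lemma base_neq0 : x != 0. Proof. by rewrite -normr_gt0 base_gt0. Qed.

Lemma ler_base_exp m n : (m <= n)%N -> a ^+ m <= a ^+ n.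
Proof. by move=> mn; rewrite ler_weXn2l // base_ge1. Qed.

Lemma double_base_exp n : 2 * a ^+ n <= a ^+ n.+1.
Proof. by rewrite exprS ler_pM2r ?base_exp_gt0. Qed.

(** As |x| >= 2, a factor 2 is absorbed by one power of |x|. All estimates can thus be pure powers,
    constants only adding O(s) to the exponents. *)
Lemma subX_bounds i j : (j < i)%N ->
  a ^+ i.-1 <= `|x ^+ i - x ^+ j| <= a ^+ i.+1.
Proof.
case: i => // i ji /=.
have := double_base_exp i; have := double_base_exp i.+1.
have : a ^+ j <= a ^+ i by apply: ler_base_exp.
have := ler_normB (x ^+ i.+1) (x ^+ j); have := lerB_normD (x ^+ i.+1) (- x ^+ j).
rewrite normrN !normrX; move=> *; apply/andP; split; lra.
Qed.

Lemma subX1_bounds i : a ^+ i <= `|x ^+ i.+1 - 1| <= a ^+ i.+2.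
Proof. by have := @subX_bounds i.+1 0 isT. Qed.

Lemma exp_neq1 m : x ^+ m.+1 != 1.
Proof.
rewrite -subr_eq0 -normr_gt0; apply: lt_le_trans (base_exp_gt0 m) _.
by case/andP: (subX1_bounds m).
Qed.

Lemma prod_norm_bounds n (f : 'I_n -> R) (l u : 'I_n -> nat) :
  (forall i, a ^+ l i <= `|f i| <= a ^+ u i) ->
  a ^+ (\sum_i l i) <= `|\prod_i f i| <= a ^+ (\sum_i u i).
Proof.
move=> h; rewrite normr_prod -!prodrXr; apply/andP; split.
  by apply: ler_prod => i _; rewrite ltW ?base_exp_gt0 //=; case/andP: (h i).
by apply: ler_prod => i _; rewrite normr_ge0 /=; case/andP: (h i).
Qed.

Lemma sum_ord_addn n c : (\sum_(i < n) (i + c) = 'C(n, 2) + n * c)%N.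
Proof.
rewrite big_split /= sum_nat_const card_ord; congr (_ + _)%N.
by rewrite -(big_mkord xpredT id) bin2_sum.
Qed.

(** The Gaussian binomial has degree k l in [x]; the extra 2k is the loss from bounding each factor
    separately. *)
Lemma qbin_bound k l : `|qbin x (k + l) k| <= a ^+ (k * l + 2 * k).
Proof.
have E : qbin x (k + l) k * qfact x k = \prod_(j < k) (x ^+ (l + j.+1) - 1).
  have := qbin_fact x k l; rewrite [(k + l)%N in RHS]addnC qfactD mulrC.
  by move=> /(mulfI (qfact_neq0 exp_neq1 l)).
have /andP[lo _] : a ^+ 'C(k, 2) <= `|qfact x k| <= a ^+ (\sum_(i < k) (i + 2)).
  have := sum_ord_addn k 0; rewrite muln0 addn0 => <-.
  by apply: prod_norm_bounds => i; rewrite addn0 addn2 subX1_bounds.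
have /andP[_ up] : a ^+ (\sum_(i < k) (i + l)) <= `|\prod_(j < k) (x ^+ (l + j.+1) - 1)|
    <= a ^+ (\sum_(i < k) (i + l.+2)).
  apply: prod_norm_bounds => i; rewrite (_ : (l + i.+1 = (i + l).+1)%N); last lia.
  by rewrite !addnS subX1_bounds.
rewrite -(ler_pM2r (base_exp_gt0 'C(k, 2))) -exprD.
apply: (le_trans (y := `|qbin x (k + l) k| * `|qfact x k|)).
  by rewrite ler_wpM2l.
rewrite -normrM E (le_trans up) // ler_base_exp // sum_ord_addn; lia.
Qed.

(** The exponents add up to C(s,2) + 3sk - k^2/2 + 9k/2, which increases for k <= 2s; the bound is
    its value at k = 2s. *)
Lemma legendre_coef_bound s k : (k <= 2 * s)%N ->
  `|legendre_coef x s k| <= a ^+ ('C(s.+1, 2) + 4 * s ^ 2 + 8 * s).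
Proof.
move=> ks; rewrite /legendre_coef !normrM normrX.
have h1 := qbin_bound k (2 * s).
have h2 := qbin_bound k (2 * s - k); rewrite subnKC // in h2.
have := ler_pM (normr_ge0 _) (normr_ge0 _) h1 h2; rewrite -exprD => h3.
rewrite -mulrA (le_trans (ler_wpM2l (ltW (base_exp_gt0 _)) h3)) // -exprD ler_base_exp //.
have := legendre_expE s k; have := bin2S_double k; have := bin2S_double s.
have : ('C(s.+1, 2) = 'C(s, 2) + s)%N by rewrite binS bin1 addnC.
move: 'C(s.+1, 2) 'C(k.+1, 2) 'C(s, 2) (legendre_exp s k) => B C D e BE.
rewrite {}BE => h1b h2b h3b.
have [d kE] : exists d, (2 * s = k + d)%N by exists (2 * s - k)%N; lia.
have -> : (2 * s - k = d)%N by lia.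
nia.
Qed.

Lemma sum_legendre_coef_bound s :
  `|\sum_(k < (2 * s).+1) legendre_coef x s k| <= a ^+ ('C(s.+1, 2) + 4 * s ^ 2 + 10 * s).
Proof.
have -> : ('C(s.+1, 2) + 4 * s ^ 2 + 10 * s =
  2 * s + ('C(s.+1, 2) + 4 * s ^ 2 + 8 * s))%N by lia.
apply: le_trans (ler_norm_sum _ _ _) _.
apply: (le_trans (y := \sum_(k < (2 * s).+1) a ^+ ('C(s.+1, 2) + 4 * s ^ 2 + 8 * s))).
  by apply: ler_sum => k _; apply: legendre_coef_bound; rewrite -ltnS.
rewrite sumr_const card_ord -mulr_natl [X in _ <= X]exprD ler_wpM2r ?(ltW (base_exp_gt0 _)) //.
apply: (le_trans (y := 2 ^+ (2 * s))).
  by rewrite -natrX ler_nat ltn_expl.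
by rewrite lerXn2r ?nnegrE ?normr_ge0.
Qed.

Lemma denom_bounds s :
  a ^+ ('C(s, 2) + s ^ 2) <= `|denom x s| <= a ^+ ('C(s, 2) + s ^ 2 + 2 * s).
Proof.
have -> : ('C(s, 2) + s ^ 2 = \sum_(i < s) (i + s))%N by rewrite sum_ord_addn mulnn.
have -> : (\sum_(i < s) (i + s) + 2 * s = \sum_(i < s) (i + s.+2))%N.
  by rewrite !sum_ord_addn; lia.
apply: prod_norm_bounds => i; rewrite (_ : (s + i.+1 = (i + s).+1)%N); last lia.
by rewrite !addnS subX1_bounds.
Qed.

(** The numerator has order 4s^2 + 2s, the two factors of the denominator 2s^2 + s and 6s^2 + 5s +
    1, so the true order is -(4s^2 + 4s + 1). *)
Lemma kernel_first_bounds s :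
  1 <= `|kernel_fun x s (2 * s).+1| * a ^+ (4 * s ^ 2 + 8 * s + 2) /\
  `|kernel_fun x s (2 * s).+1| * a ^+ (4 * s ^ 2) <= 1.
Proof.
have /andP[nl nu] : a ^+ (\sum_(j < 2 * s) 2 * s) <=
    `|\prod_(j < 2 * s) (x ^+ (2 * s).+1 - x ^+ j.+1)| <= a ^+ (\sum_(j < 2 * s) (2 * s).+2).
  by apply: prod_norm_bounds => j; apply: (@subX_bounds (2 * s).+1); rewrite ltnS.
have /andP[dl du] : a ^+ (\sum_(k < (2 * s).+1) (k + 2 * s)) <=
    `|\prod_(k < (2 * s).+1) (1 - x ^+ (k + (2 * s).+1))| <=
    a ^+ (\sum_(k < (2 * s).+1) (k + (2 * s).+2)).
  by apply: prod_norm_bounds => k; rewrite distrC !addnS subX1_bounds.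
move: nl nu dl du; rewrite !sum_ord_addn !sum_nat_const !card_ord => nl nu dl du.
rewrite /kernel_fun normrM normfV normrM normrX.
have C : ('C((2 * s).+1, 2) = 2 * s ^ 2 + s)%N.
  by have := bin2S_double (2 * s); nia.
rewrite C in dl du.
set N := `|\prod_(j < _) _| in nl nu *; set D := `|\prod_(k < _) _| in dl du *.
have D0 : 0 < D by apply: lt_le_trans dl; rewrite base_exp_gt0.
have P0 := base_exp_gt0 ((2 * s).+1 * s).
split.
  rewrite mulrAC ler_pdivlMr ?mulr_gt0 // mul1r.
  apply: (le_trans (ler_wpM2l (ltW P0) du)).
  apply: le_trans (ler_wpM2r (ltW (base_exp_gt0 _)) nl).
  by rewrite -!exprD ler_base_exp //; nia.
rewrite mulrAC ler_pdivrMr ?mulr_gt0 // mul1r.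
apply: le_trans (ler_wpM2l (ltW P0) dl).
apply: (le_trans (ler_wpM2r (ltW (base_exp_gt0 _)) nu)).
by rewrite -!exprD ler_base_exp //; nia.
Qed.

Lemma kernel_ratio s t : (5 <= s)%N -> (2 * s < t)%N ->
  4 * `|kernel_fun x s t.+1| <= `|kernel_fun x s t|.
Proof.
move=> s5 st; have t0 : (0 < t)%N by lia.
have := congr1 Num.norm (kernel_funS base_neq0 exp_neq1 s t0).
move: (kernel_fun x s t.+1) (kernel_fun x s t) => k' k.
rewrite !normrM !normrX; move: (`|k'|) (`|k|) (normr_ge0 k') (normr_ge0 k) => K' K K'0 K0.
have /andP[l1 _] := subX_bounds st.
have /andP[l2 _] := subX1_bounds (t + 2 * s).
rewrite distrC in l2.
have /andP[_ u1] : a ^+ t.-1 <= `|x ^+ t - 1| <= a ^+ t.+1 by rewrite -(prednK t0) subX1_bounds.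
have u2 := u1; rewrite distrC in u2.
move=> E.
have L := ler_pM (ltW (base_exp_gt0 _)) (ltW (base_exp_gt0 _)) l1 l2.
have U := ler_pM (normr_ge0 _) (normr_ge0 _) u1 u2.
have {L} : K' * (a ^+ s * (a ^+ t.-1 * a ^+ (t + 2 * s))) <=
  K * (a ^+ (2 * s) * (a ^+ t.+1 * a ^+ t.+1)).
  apply: (le_trans (y := K' * (a ^+ s * (`|x ^+ t - x ^+ (2 * s)| * `|1 - x ^+ (t + 2 * s).+1|)))).
    by rewrite ler_wpM2l // ler_wpM2l ?(ltW (base_exp_gt0 _)).
  by rewrite E ler_wpM2l // ler_wpM2l ?(ltW (base_exp_gt0 _)).
rewrite -!exprD.
(* The recurrence yields a decay by at least |x|^(s - 3), and s >= 5 makes this at least 4. *)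
have -> : (s + (t.-1 + (t + 2 * s)) = (s - 3) + (2 * s + (t.+1 + t.+1)))%N by lia.
rewrite exprD mulrA ler_pM2r ?base_exp_gt0 //; apply: le_trans.
rewrite mulrC ler_wpM2l // (le_trans _ (ler_base_exp (_ : 2 <= s - 3)%N)) //; last lia.
by rewrite expr2; apply: le_trans (ler_pM _ _ x2 x2); rewrite ?ler0n // -natrM.
Qed.

(** A geometric tail of ratio at most 1/4 is at most a third of the term before it. Subtracting the
    last term on the right makes the induction telescope. *)
Lemma kernel_tail s m : (5 <= s)%N ->
  3 * `|\sum_(i < m) (-1) ^+ i * kernel_fun x s ((2 * s).+2 + i)| <=
  `|kernel_fun x s (2 * s).+1| - `|kernel_fun x s ((2 * s).+1 + m)|.
Proof.
move=> s5; elim: m => [|m IH].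
  by rewrite big_ord0 normr0 addn0 subrr mulr0.
rewrite big_ord_recr /=.
have := ler_normD (\sum_(i < m) (-1) ^+ i * kernel_fun x s ((2 * s).+2 + i))
  ((-1) ^+ m * kernel_fun x s ((2 * s).+2 + m)).
rewrite normrM normr_sign mul1r => h.
have := kernel_ratio s5 (_ : (2 * s < (2 * s).+1 + m)%N); rewrite addnS -addSn => /(_ ltac:(lia)).
lra.
Qed.

End Bounds.

(** * Limits of the alternating sums and the integral linear forms *)

Local Open Scope classical_set_scope.

Definition alt_sum (F : fieldType) (x : F) (m : nat) : F :=
  \sum_(i < m) (-1) ^+ i.+1 / (x ^+ i.+1 - 1).

Lemma cvg_sum_ord (R : realType) n (f : 'I_n -> nat -> R) (l : 'I_n -> R) :
  (forall i, f i m @[m --> \oo] --> l i) ->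
  \sum_i f i m @[m --> \oo] --> \sum_i l i.
Proof.
elim: n f l => [|n IH] f l fl.
  rewrite big_ord0; under eq_fun do rewrite big_ord0; exact: cvg_cst.
rewrite big_ord_recr; under eq_fun do rewrite big_ord_recr /=.
by apply: cvgD => //; apply: IH => i.
Qed.

Lemma cvgn_norm_bounds (R : realType) (u : nat -> R) (l lo hi : R) :
  u @ \oo --> l -> (forall m, lo <= `|u m| <= hi) -> lo <= `|l| <= hi.
Proof.
move=> /cvg_norm ul h; have cu : cvgn (fun m => `|u m|) by apply/cvg_ex; exists `|l|.
rewrite -(cvg_lim _ ul) //; apply/andP; split.
  by apply: limr_ge => //; near=> m; case/andP: (h m).
by apply: limr_le => //; near=> m; case/andP: (h m).
Unshelve. all: by end_near. Qed.

Section Series.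
Variables (R : realType) (x : R).
Hypothesis x2 : 2 <= `|x|.

Lemma alt_sum_cvg : cvgn (alt_sum x).
Proof.
pose u k : R := (-1) ^+ k.+1 / (x ^+ k.+1 - 1).
have -> : alt_sum x = series u.
  by apply/funext => m; rewrite /alt_sum /series /= big_mkord.
apply: normed_cvg; apply: (@series_le_cvg _ _ (geometric 1 `|x|^-1)) => //=.
- move=> n; rewrite /u normrM normr_sign !mul1r normfV exprVn lef_pV2.
  + by case/andP: (subX1_bounds x2 n).
  + rewrite posrE; apply: lt_le_trans (base_exp_gt0 x2 n) _.
    by case/andP: (subX1_bounds x2 n).
  + by rewrite posrE base_exp_gt0.
- apply: is_cvg_geometric_series; rewrite ger0_norm ?invr_ge0 //.
  by rewrite invf_lt1 ?(base_gt0 x2) // (lt_le_trans _ x2) // ltr1n.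
Qed.

(** The residue sign (-1)^k turns (-1)^t into (-1)^(k + t), so every simple pole yields, up to sign,
    a block of the same series. Hence one number L serves for all [k]. *)
Lemma alt_sumD k m : \sum_(t < m) (-1) ^+ t.+1 * ((-1) ^+ k / (1 - x ^+ (k + t.+1))) =
  alt_sum x k - alt_sum x (m + k).
Proof.
rewrite addnC /alt_sum big_split_ord /= opprD addNKr -sumrN; apply: eq_bigr => t _.
rewrite -addnS [(-1) ^+ (k + _)]exprD -[1 - _]opprB invrN !mulrN; congr (- _).
by rewrite mulrA [(-1) ^+ k * _]mulrC.
Qed.

Lemma cvg_tail_sum k (L : R) : alt_sum x @ \oo --> L ->
  \sum_(t < m) (-1) ^+ t.+1 * ((-1) ^+ k / (1 - x ^+ (k + t.+1))) @[m --> \oo] -->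
  alt_sum x k - L.
Proof.
move=> cL; under eq_fun do rewrite alt_sumD.
by apply: cvgB; [exact: cvg_cst | rewrite (cvg_shiftn k (alt_sum x))].
Qed.

(** A geometric series with first term and ratio -x^-i; it gives the contribution of the pole at T =
    0, rational when [x] is an integer. *)
Lemma cvg_alt_geometric i : (0 < i)%N ->
  \sum_(t < m) (-1) ^+ t.+1 * (x ^+ (t.+1 * i))^-1 @[m --> \oo] --> - (x ^+ i + 1)^-1.
Proof.
move=> i0; pose z : R := - (x ^+ i)^-1.
have xi0 : x ^+ i != 0 by rewrite expf_neq0 // base_neq0.
have xi : 2 <= `|x ^+ i|.
  rewrite normrX -(prednK i0) (le_trans x2) //.
  by rewrite -{1}[`|x|]expr1 ler_base_exp.
have xi1 : x ^+ i + 1 != 0.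
  by apply: contraTneq xi => /eqP; rewrite addr_eq0 => /eqP ->; rewrite normrN1 -ltNge ltr1n.
have -> : - (x ^+ i + 1)^-1 = z * (1 - z)^-1.
  by rewrite /z; field; rewrite xi0 xi1.
have -> : (fun m => \sum_(t < m) (-1) ^+ t.+1 * (x ^+ (t.+1 * i))^-1) = series (geometric z z).
  apply/funext => m; rewrite /series /= big_mkord; apply: eq_bigr => t _.
  by rewrite -exprS [RHS]exprNn exprVn -exprM mulnC.
apply: cvg_geometric_series; rewrite normrN normfV invf_lt1.
  by rewrite (lt_le_trans _ xi) // ltr1n.
by rewrite (lt_le_trans _ xi) // ltr0n.
Qed.

Lemma Lnq2_cvg (q : int) : x = q%:~R -> alt_sum x @ \oo --> Lnq2 R q.
Proof.
move=> xq; rewrite /Lnq2; have cT := alt_sum_cvg.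
(* The upper bound n < N is strict, hence the shift by one. *)
have -> : (fun N => \sum_(1 <= n < N) ((-1) ^+ n / ((q%:~R : R) ^+ n - 1))) =
    (fun N => alt_sum x N.-1).
  by apply/funext => N; rewrite big_add1 /= big_mkord -xq.
suff -> : limn (fun N => alt_sum x N.-1) = limn (alt_sum x) by [].
apply: cvg_lim => //; rewrite -(cvg_shiftn 1) /=.
by under eq_fun do rewrite addn1 /=.
Qed.
(** The leading term is t = 2s + 1 and the rest is at most a third of it, so the sum lies between
    2/3 and 4/3 of its size. The offset ensures that every partial sum contains this term. *)
Lemma kernel_sum_bounds s m : (5 <= s)%N ->
  2 * `|kernel_fun x s (2 * s).+1| <=
  3 * `|\sum_(t < m + (2 * s).+1) (-1) ^+ t.+1 * kernel_fun x s t.+1| <=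
  4 * `|kernel_fun x s (2 * s).+1|.
Proof.
move=> s5; rewrite [(m + _)%N]addnC big_split_ord /= big_ord_recr /=.
have -> : \sum_(t < 2 * s) (-1) ^+ t.+1 * kernel_fun x s t.+1 = 0.
  by apply: big1 => t _; rewrite kernel_fun_eq0 ?mulr0 //=.
rewrite add0r.
have e2 : (-1 : R) ^+ (2 * s) = 1 by rewrite exprM sqrrN !expr1n.
have -> : \sum_(i < m) (-1) ^+ ((2 * s).+1 + i).+1 * kernel_fun x s ((2 * s).+1 + i).+1 =
    \sum_(i < m) (-1) ^+ i * kernel_fun x s ((2 * s).+2 + i).
  apply: eq_bigr => t _; rewrite -!addSn; congr (_ * _).
  by rewrite exprD !exprS e2; ring.
rewrite exprS e2 mulr1 mulN1r.
have := kernel_tail x2 m s5; set T := \sum_(i < m) _; set K := kernel_fun _ _ _.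
have := ler_normD (- K) T; have := lerB_normD (- K) T; rewrite normrN.
have := normr_ge0 (kernel_fun x s ((2 * s).+1 + m)).
by move=> *; apply/andP; split; lra.
Qed.

(** Summed over t, the pole at x^-k contributes its coefficient times [alt_sum x k - L], and the
    pole at 0 the geometric sums. [A] collects all that does not involve [L]. *)
Lemma kernel_linear_form (S : subringClosed R) (L : R) s :
  x \in S -> alt_sum x @ \oo --> L ->
  exists A : R, denom x s * A \in S /\
    x ^+ 'C(s, 2) * \sum_(t < m) (-1) ^+ t.+1 * kernel_fun x s t.+1 @[m --> \oo] -->
    A - (\sum_(k < (2 * s).+1) legendre_coef x s k) * L.
Proof.
move=> xS cL.
have x0 := base_neq0 x2; have x1 := exp_neq1 x2.
have [V [VS decomp]] := kernel_decomp x0 x1 s xS.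
exists (\sum_(k < (2 * s).+1) legendre_coef x s k * alt_sum x k +
        \sum_(i < s) V i * - (x ^+ (s - i) + 1)^-1); split.
  rewrite mulrDr !mulr_sumr rpredD // rpred_sum // => k _.
    rewrite mulrCA rpredM ?legendre_coef_in // /alt_sum mulr_sumr rpred_sum // => i _.
    rewrite mulrCA rpredM ?rpredX ?rpredN ?rpred1 // denom_divB //.
    by have := ltn_ord i; have := ltn_ord k; lia.
  rewrite mulrCA mulrN rpredM // rpredN denom_divD //.
  by have := ltn_ord k; lia.
rewrite mulr_suml addrAC -sumrB.
under [X in X + _]eq_bigr do rewrite -mulrBr.
have -> : (fun m => x ^+ 'C(s, 2) * \sum_(t < m) (-1) ^+ t.+1 * kernel_fun x s t.+1) =
  (fun m => \sum_(k < (2 * s).+1) legendre_coef x s k *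
      (\sum_(t < m) (-1) ^+ t.+1 * ((-1) ^+ k / (1 - x ^+ (k + t.+1)))) +
    \sum_(i < s) V i * (\sum_(t < m) (-1) ^+ t.+1 * (x ^+ (t.+1 * (s - i)))^-1)).
  apply/funext => m; rewrite mulr_sumr.
  under [X in _ = X + _]eq_bigr do rewrite mulr_sumr.
  under [X in _ = _ + X]eq_bigr do rewrite mulr_sumr.
  rewrite exchange_big [X in _ = _ + X]exchange_big -big_split /=.
  apply: eq_bigr => t _; rewrite mulrCA decomp // mulrDr !mulr_sumr.
  by congr (_ + _); apply: eq_bigr => k _; ring.
apply: cvgD; apply: cvg_sum_ord => k; apply: cvgM; try exact: cvg_cst.
  exact: cvg_tail_sum.
by apply: cvg_alt_geometric; have := ltn_ord k; lia.
Qed.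

(** Leading exponents: 3/2 s^2 for [denom], 1/2 s^2 for x^C(s,2) and -4s^2 for the kernel give -2s^2
    for the form; 3/2 s^2 + 9/2 s^2 = 6s^2 bounds [b]. *)
Lemma Lnq2_approx (q : int) s : x = q%:~R -> (5 <= s)%N ->
  exists b c : int,
  [/\ 1 <= `|b%:~R * Lnq2 R q - c%:~R| * `|x| ^+ (2 * s ^ 2 + 9 * s + 3),
      `|b%:~R * Lnq2 R q - c%:~R| * `|x| ^+ (2 * s ^ 2) <= `|x| ^+ s.+1 &
      `|b%:~R : R| <= `|x| ^+ (6 * s ^ 2 + 12 * s)].
Proof.
move=> xq s5; have xint : x \is a Num.int by rewrite xq intr_int.
have x1 := exp_neq1 x2.
have [A [DA cvgA]] := kernel_linear_form s xint (Lnq2_cvg xq).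
set B := \sum_(k < _) _ in cvgA.
have DB : denom x s * B \is a Num.int.
  by rewrite rpredM ?denom_in // rpred_sum // => k _; rewrite legendre_coef_in.
have [b bE] := intrP DB; have [c cE] := intrP DA.
exists b, c; rewrite -bE -cE.
have -> : denom x s * B * Lnq2 R q - denom x s * A = - (denom x s * (A - B * Lnq2 R q)) by ring.
rewrite normrN !normrM.
have [k1 k2] := kernel_first_bounds x2 s.
have C2 : ('C(s.+1, 2) = 'C(s, 2) + s)%N by rewrite binS bin1 addnC.
have C1 : ('C(s, 2) * 2 + s = s ^ 2)%N.
  by have := bin2S_double s; rewrite C2 mulSn mulnn; clear; lia.
have /andP[d1 d2] := denom_bounds x2 s.
have B1 := sum_legendre_coef_bound x2 s; rewrite -/B in B1.
have a0 n := base_exp_gt0 x2 n; have a0' n := ltW (a0 n).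
have : 2 * (`|x| ^+ 'C(s, 2) * `|kernel_fun x s (2 * s).+1|) <= 3 * `|A - B * Lnq2 R q| <=
       4 * (`|x| ^+ 'C(s, 2) * `|kernel_fun x s (2 * s).+1|).
  have := cvgn_norm_bounds (u := fun m => x ^+ 'C(s, 2) *
    \sum_(t < m + (2 * s).+1) (-1) ^+ t.+1 * kernel_fun x s t.+1)
    (lo := 2 / 3 * (`|x| ^+ 'C(s, 2) * `|kernel_fun x s (2 * s).+1|))
    (hi := 4 / 3 * (`|x| ^+ 'C(s, 2) * `|kernel_fun x s (2 * s).+1|)) _ _.
  move=> /(_ (A - B * Lnq2 R q)) h.
  have /andP[] : 2 / 3 * (`|x| ^+ 'C(s, 2) * `|kernel_fun x s (2 * s).+1|) <=
     `|A - B * Lnq2 R q| <= 4 / 3 * (`|x| ^+ 'C(s, 2) * `|kernel_fun x s (2 * s).+1|).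
    apply: h; first by rewrite (cvg_shiftn (2 * s).+1
      (fun m => x ^+ 'C(s, 2) * \sum_(t < m) (-1) ^+ t.+1 * kernel_fun x s t.+1)).
    move=> m; rewrite /= [`|x ^+ _ * _|]normrM normrX.
    have /andP[e1 e2] := kernel_sum_bounds m s5.
    have := ler_wpM2l (a0' 'C(s, 2)) e1; have := ler_wpM2l (a0' 'C(s, 2)) e2.
    by move=> *; apply/andP; split; lra.
  by move=> *; apply/andP; split; lra.
set K := `|kernel_fun _ _ _| in k1 k2 *; set E := `|A - _ * _|.
have K0 : 0 <= K by exact: normr_ge0.
have E0 : 0 <= E by exact: normr_ge0.
set D := `|denom x s| in d1 d2 *.
case/andP=> e1 e2; split.
- have h1 := ler_wpM2r E0 d1; have h2 := ler_wpM2l (a0' ('C(s, 2) + s ^ 2)%N) e1.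
  have h3 := ler_wpM2r (a0' (2 * s ^ 2 + 9 * s + 3)%N) h1.
  have h4 := ler_wpM2r (a0' (2 * s ^ 2 + 9 * s + 3)%N) h2.
  have E1 : `|x| ^+ ('C(s, 2) + s ^ 2) * (2 * (`|x| ^+ 'C(s, 2) * K)) * `|x| ^+ (2 * s ^ 2 + 9 * s + 3)
     = 2 * (`|x| * (K * `|x| ^+ (4 * s ^ 2 + 8 * s + 2))).
    rewrite [`|x| * _]mulrCA -exprS.
    have -> : (4 * s ^ 2 + 8 * s + 2).+1 = (('C(s, 2) + s ^ 2) + 'C(s, 2) + (2 * s ^ 2 + 9 * s + 3))%N by move: C1; clear; lia.
    by rewrite !exprD; ring.
  rewrite {}E1 in h4.
  have h5 := ler_pM (ler0n R 2) ler01 x2 k1.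
  by move: h3 h4 h5; rewrite -!mulrA; lra.
- have h1 := ler_wpM2r E0 d2; have h2 := ler_wpM2l (a0' ('C(s, 2) + s ^ 2 + 2 * s)%N) e2.
  have h3 := ler_wpM2r (a0' (2 * s ^ 2)%N) h1.
  have h4 := ler_wpM2r (a0' (2 * s ^ 2)%N) h2.
  have E1 : `|x| ^+ ('C(s, 2) + s ^ 2 + 2 * s) * (4 * (`|x| ^+ 'C(s, 2) * K)) * `|x| ^+ (2 * s ^ 2)
     = 4 * (`|x| ^+ s * (K * `|x| ^+ (4 * s ^ 2))).
    rewrite [`|x| ^+ s * _]mulrCA -exprD.
    have -> : (s + 4 * s ^ 2 = ('C(s, 2) + s ^ 2 + 2 * s) + 'C(s, 2) + 2 * s ^ 2)%N by move: C1; clear; lia.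
    by rewrite !exprD; ring.
  rewrite {}E1 in h4.
  have h5 := ler_wpM2l (a0' s) k2; have h6 := double_base_exp x2 s.
  have h7 := a0 s.
  by move: h3 h4 h5 h6; rewrite mulr1 -!mulrA; lra.
- apply: le_trans (ler_pM (normr_ge0 _) (normr_ge0 _) d2 B1) _.
  by rewrite -exprD ler_base_exp //; move: C2 C1; clear; lia.
Qed.
End Series.

(** * From the linear forms to irrationality and its measure *)

Lemma le_exp_powR (R : realType) (a r : R) (k m : nat) :
  1 <= a -> a ^+ k <= r -> (10 * m <= 48 * k)%N -> a ^+ m <= r `^ (48%:R / 10%:R).
Proof.
move=> a1 kr mk; have a0 : 0 <= a by apply: le_trans a1.
have ak : 0 <= a ^+ k by rewrite exprn_ge0.
apply: (le_trans (y := (a ^+ k) `^ (48%:R / 10%:R))); last first.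
  by apply: ge0_ler_powR; rewrite ?nnegrE ?divr_ge0 ?ler0n //; apply: le_trans kr.
rewrite -!powR_mulrn // -powRrM ler_powR // mulrA ler_pdivlMr ?ltr0n //.
by rewrite -!natrM ler_nat; lia.
Qed.

Lemma finite_box (K N : nat) :
  finite_set [set pr : int * int | (`|pr.1| <= K%:Z) /\ (1 <= pr.2 <= N%:Z)].
Proof.
apply: (@sub_finite_set _ _ (((fun i : nat => i%:Z - K%:Z) @` `I_(2 * K).+1) `*`
   ((fun i : nat => i%:Z) @` `I_N.+1))); last first.
  by apply: finite_setX; apply: finite_image; apply: finite_II.
move=> [p r] /= [pK rN]; split => /=.
  exists (absz (p + K%:Z)) => /=; lia.
exists (absz r) => /=; lia.
Qed.

Section Measure.
Variables (R : realType) (q : int).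
Local Notation x := (q%:~R : R).
Local Notation a := (`|x|).
Local Notation L := (Lnq2 R q).
Hypothesis x2 : 2 <= a.

(** If b p = r c, then |b L - c| = |b| |L - p/r| and the lower bound on the form applies. Otherwise
    the integer b p - r c has modulus at least 1, while the condition on [r] makes r |b L - c| at
    most 1/2, so r |b| |L - p/r| is at least 1/2. *)
Lemma approx_lower_bound s (p r : int) : (5 <= s)%N -> 1 <= r ->
  2 * r%:~R * a ^+ s.+1 <= a ^+ (2 * s ^ 2) ->
  1 <= `|L - p%:~R / r%:~R| * a ^+ (8 * s ^ 2 + 21 * s + 3).
Proof.
move=> s5 r1 rs; have [b [c [e1 e2 B]]] := Lnq2_approx x2 erefl s5.
have r0 : 1 <= r%:~R :> R by rewrite -[1]/(1%:~R) ler_int.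
move: e1 e2; set e := `|_ - c%:~R| => e1 e2; set y := `|L - _|.
have y0 : 0 <= y by exact: normr_ge0.
have a0 n := base_exp_gt0 x2 n.
have [bpc|bpc] := eqVneq (b * p - r * c) 0.
  have ey : e = `|b%:~R| * y.
    rewrite /e /y -normrM; congr Num.norm.
    have : (b * p)%:~R = (r * c)%:~R :> R by congr (_%:~R); lia.
    rewrite !intrM mulrBr mulrA => ->; field.
    by rewrite gt_eqF // (lt_le_trans _ r0).
  apply: (le_trans e1); rewrite ey -mulrA mulrCA ler_wpM2l //.
  apply: le_trans (ler_wpM2r (ltW (a0 _)) B) _.
  by rewrite -exprD ler_base_exp //; clear; lia.
have h1 : 1 <= `|(b * p - r * c)%:~R| :> R.
  by rewrite norm_intr_ge1 ?intr_int // intr_eq0.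
have h2 : (b * p - r * c)%:~R = r%:~R * (b%:~R * L - c%:~R) - r%:~R * b%:~R * (L - p%:~R / r%:~R) :> R.
  rewrite intrB !intrM; field.
  by rewrite gt_eqF // (lt_le_trans _ r0).
have h3 : 1 <= r%:~R * e + r%:~R * `|b%:~R| * y.
  apply: (le_trans h1); rewrite h2 (le_trans (ler_normB _ _)) // !normrM.
  by rewrite (ger0_norm (le_trans ler01 r0)).
have h4 : 2 * r%:~R * e <= 1.
  have r2 : 0 <= 2 * r%:~R :> R by rewrite mulr_ge0 // (le_trans _ r0).
  have := le_trans (ler_wpM2l r2 e2) rs.
  by rewrite mulrA -ler_pdivlMr ?divff ?gt_eqF.
have h5 : 1 <= (2 * r%:~R * `|b%:~R|) * y by lra.
apply: (le_trans h5); rewrite [X in X <= _]mulrC ler_wpM2l //.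
rewrite -(ler_pM2r (a0 s.+1)) mulrAC.
apply: (le_trans (ler_pM _ (normr_ge0 _) rs B)).
  by rewrite mulr_ge0 ?(ltW (a0 _)) // mulr_ge0 //; apply: le_trans r0.
by rewrite -!exprD ler_base_exp //; clear; lia.
Qed.

Lemma approx_index_exists (r : int) : 1 <= r -> exists s : nat,
  (30 <= s)%N && (2 * r%:~R * a ^+ s.+1 <= a ^+ (2 * s ^ 2)).
Proof.
(* Any large [s] works, since the exponent on the right is quadratic; here 2r = m <= 2^m <=
   |x|^m. *)
move=> r1; pose m := (2 * absz r)%N; exists (30 + m)%N; rewrite leq_addr /=.
have -> : 2 * r%:~R = m%:R :> R.
  by rewrite /m natrM; congr (_ * _); rewrite pmulrn; congr (_%:~R); lia.
apply: (le_trans (y := a ^+ m * a ^+ (30 + m).+1)).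
  rewrite ler_wpM2r ?(ltW (base_exp_gt0 x2 _)) //.
  apply: (le_trans (y := 2 ^+ m)); first by rewrite -natrX ler_nat ltnW // ltn_expl.
  by rewrite lerXn2r ?nnegrE ?normr_ge0.
by rewrite -exprD ler_base_exp //; clear; lia.
Qed.

(** For L = p/r the lower bound would read 1 <= 0. *)
Lemma Lnq2_irrational : irrational L.
Proof.
move=> [z _ zL].
have d1 : 1 <= denq z by have := denq_gt0 z; lia.
have [s /andP[s30 rs]] := approx_index_exists d1.
have := approx_lower_bound (numq z) (leq_trans _ s30) d1 rs.
by move=> /(_ isT); rewrite -zL /ratr subrr normr0 mul0r ler10.
Qed.

(** The least admissible [s] is used: minimality bounds [r] from below by about |x|^(2s^2), against
    |L - p/r| >= |x|^-(8s^2 + O(s)). The limiting ratio is 4, and 4.8 absorbs the linear terms once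
    s > 30. *)
Lemma Lnq2_good_approx (p r : int) : 1 <= r ->
  `|L - p%:~R / r%:~R| < (r%:~R `^ (48%:R / 10%:R))^-1 -> r%:~R < a ^+ (8 * 30 ^ 2 + 21 * 30 + 3).
Proof.
move=> r1 y_lt; rewrite ltNge; apply/negP => rM.
have [] := ex_minnP (approx_index_exists r1) => s /andP[s30 rs] smin.
have a1 := base_ge1 x2.
have r0 : 0 < r%:~R :> R by rewrite ltr0z; lia.
have := approx_lower_bound p (leq_trans (isT : 5 <= 30)%N s30) r1 rs.
rewrite leNgt => /negP; apply; rewrite -ltr_pdivlMr ?(base_exp_gt0 x2) // mul1r.
apply: (lt_le_trans y_lt).
rewrite lef_pV2 ?posrE ?powR_gt0 ?(base_exp_gt0 x2) //.
(* At s = 30 minimality says nothing; instead the assumed size of [r] is exactly the power of |x|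
   required. *)
have [s31|s31] := leqP s 30.
  have -> : s = 30%N by lia.
  by apply: (le_exp_powR a1 rM); rewrite leq_mul2r.
have : ~~ ((30 <= s.-1)%N && (2 * r%:~R * a ^+ s.-1.+1 <= a ^+ (2 * s.-1 ^ 2))).
  by apply/negP => /smin; lia.
have -> /= : (30 <= s.-1)%N by lia.
rewrite -ltNge prednK; last by lia.
(* Failure at s - 1 gives |x|^(2(s-1)^2) < 2 r |x|^s, the 2 costing one more power. For s > 30,
   10(8s^2 + 21s + 3) <= 48(2(s-1)^2 - s - 1). *)
move=> h; apply: (le_exp_powR (k := (2 * s.-1 ^ 2 - s - 1)%N) a1); last by nia.
rewrite -(ler_pM2r (base_exp_gt0 x2 s.+1)) -exprD.
have -> : (2 * s.-1 ^ 2 - s - 1 + s.+1 = 2 * s.-1 ^ 2)%N by nia.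
apply: (le_trans (ltW h)); rewrite exprS mulrA ler_wpM2r ?(ltW (base_exp_gt0 x2 _)) //.
by rewrite mulrC ler_wpM2l // ltW.
Qed.

Lemma Lnq2_finitely_many : finitely_many_approx L (48%:R / 10%:R).
Proof.
have a0 n := ltW (base_exp_gt0 x2 n).
have [M good] : exists M, forall p r : int, 1 <= r ->
    `|L - p%:~R / r%:~R| < (r%:~R `^ (48%:R / 10%:R))^-1 -> r%:~R < a ^+ M.
  by exists (8 * 30 ^ 2 + 21 * 30 + 3)%N => p r; apply: Lnq2_good_approx.
pose N := Num.bound (a ^+ M); pose K := Num.bound (a ^+ M * (`|L| + 1)).
have NP : a ^+ M < N%:R by have := archi_boundP (a0 M).
have KP : a ^+ M * (`|L| + 1) < K%:R.
  by apply: archi_boundP; rewrite mulr_ge0 // addr_ge0.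
apply: sub_finite_set (finite_box K N) => -[p r] /= [r1 y_lt].
have rM := good _ _ r1 y_lt.
have r1' : 1 <= r%:~R :> R by rewrite -[1]/(1%:~R) ler_int.
have r0 : 0 < r%:~R :> R by apply: lt_le_trans r1'.
split; last first.
  by rewrite r1 -(ler_int R) /= ltW // (lt_trans rM).
(* With [r] bounded, this bounds |p| by r(|L| + 1), leaving a finite box of pairs. *)
have y1 : `|L - p%:~R / r%:~R| <= 1.
  apply: le_trans (ltW y_lt) _; rewrite invf_le1 ?powR_gt0 //.
  exact: (@le_exp_powR R 1 r%:~R 0 0 (lexx 1) r1' isT).
rewrite -(ler_int R) /= intr_norm.
apply: (le_trans (y := a ^+ M * (`|L| + 1))); last exact: ltW.
have -> : p%:~R = r%:~R * (p%:~R / r%:~R) :> R by field; rewrite gt_eqF.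
rewrite normrM (ger0_norm (ltW r0)) ler_pM ?(ltW rM) ?(ltW r0) //.
have := ler_normB L (L - p%:~R / r%:~R).
have -> : L - (L - p%:~R / r%:~R) = p%:~R / r%:~R by ring.
by lra.
Qed.
End Measure.

Theorem theorem2 (R : realType) (q : int) (hq0 : `|q| != 0) (hq1 : `|q| != 1) :
  irrational (Lnq2 R q) /\ (irr_measure (Lnq2 R q) <= ((48%:R / 10%:R : R)%:E))%E.
Proof.
have x2 : 2 <= `|q%:~R : R| by rewrite -intr_norm -[2]/(2%:~R) ler_int; lia.
split; first exact: Lnq2_irrational.
apply: ereal_inf_lbound; exists (48%:R / 10%:R) => //.
exact: Lnq2_finitely_many.
Qed.
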